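(* Let $\mathfrak g$ be a restricted Lie algebra over $\mathbb F$. The equivalence classes of restricted infinitesimal deformations of $\mathfrak g$ coincide with the elements of $H^2(\mathfrak g;\mathfrak g)$ (the deformation $(\varphi,\omega)$ corresponding to the cohomology class of $(\varphi,\omega)$), where $\mathfrak g$ is a $\mathfrak g$-module by the adjoint action.
   Context: $\mathbb F$ is a field of characteristic $p>0$. Left-normed brackets: $[g_1,g_2,\dots,g_k]=[[\cdots[[g_1,g_2],g_3]\cdots],g_k]$ (with $[g_1]=g_1$). A restricted Lie algebra is a Lie algebra $\mathfrak g$ over $\mathbb F$ with a map $g\mapsto g^{[p]}$ such that (R1) $(\lambda g)^{[p]}=\lambda^pg^{[p]}$; (R2) $(g+h)^{[p]}=g^{[p]}+h^{[p]}+\sum\frac1{\#(g)}[g_1,\dots,g_p]$, the sum over words $(g_1,\dots,g_p)$ in the letters $g,h$ with $g_1=g$, $g_2=h$, where $\#(g)$ is the number of letters $g$ in the word; (R3) $[g,h^{[p]}]=[g,h,\dots,h]$ ($p$ copies of $h$). A restricted infinitesimal deformation of $\mathfrak g$ is a pair $(\varphi,\omega)$ consisting of a skew-symmetric (alternating) bilinear map $\varphi:\mathfrak g\times\mathfrak g\to\mathfrak g$ and a map $\omega:\mathfrak g\to\mathfrak g$ such that $$[g,h]_t=[g,h]+\varphi(g,h)t,\qquad g^{[p]_t}=g^{[p]}+\omega(g)t$$ define a restricted Lie algebra structure modulo $t^2$: that is, with $t$ a formal parameter, in $(\mathbb F[t]/(t^2))\otimes_{\mathbb F}\mathfrak g$,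 with $[\cdot,\cdot]_t$ extended $\mathbb F[t]/(t^2)$-bilinearly, the Jacobi identity holds and (R1)–(R3) hold for all $g,h\in\mathfrak g$, $\lambda\in\mathbb F$, with $[\cdot,\cdot]_t$ and $\cdot^{[p]_t}$ in place of $[\cdot,\cdot]$ and $\cdot^{[p]}$. Two restricted infinitesimal deformations $(\varphi_1,\omega_1)$, $(\varphi_2,\omega_2)$ are equivalent if there is a linear map $\psi:\mathfrak g\to\mathfrak g$ with $$\varphi_1(g,h)-\varphi_2(g,h)=\psi([g,h])-[g,\psi(h)]-[\psi(g),h],\qquad \omega_1(g)-\omega_2(g)=\psi(g^{[p]})-[\psi(g),\underbrace{g,\dots,g}_{p-1}].$$ Cohomology: for a restricted $\mathfrak g$-module $M$ (a $\mathfrak g$-module with $g^{[p]}x=g^px$), let $C^q_{\rm cl.}(\mathfrak g;M)=\operatorname{Hom}_{\mathbb F}(\Lambda^q\mathfrak g,M)$, $\delta_{\rm cl.}\psi(g,h)=-g\psi(h)+h\psi(g)+\psi([g,h])$ and $\delta_{\rm cl.}\varphi(g,h,f)=\varphi([g,h],f)-\varphi([g,f],h)+\varphi([h,f],g)-g\varphi(h,f)+h\varphi(g,f)-f\varphi(g,h)$. $C^2(\mathfrak g;M)$ is the space of pairs $(\varphi,\omega)$ with $\varphi\in C^2_{\rm cl.}(\mathfrak g;M)$ and $\omega:\mathfrak g\to M$ having the $*$-property with respect to $\varphi$: $\omega(\lambda g)=\lambda^p\omega(g)$ and $$\omega(g+h)=\omega(g)+\omega(h)+\sum_{\substack{g_j=g\text{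 or }h\\ g_1=g,\,g_2=h}}\frac1{\#(g)}\sum_{k=0}^{p-2}(-1)^kg_p\cdots g_{p-k+1}\varphi([g_1,\dots,g_{p-k-1}],g_{p-k}).$$ For $\psi\in C^1(\mathfrak g;M)=\operatorname{Hom}_{\mathbb F}(\mathfrak g,M)$, $\delta^1\psi=(\delta_{\rm cl.}\psi,\tilde\psi)$ with $\tilde\psi(g)=\psi(g^{[p]})-g^{p-1}\psi(g)$. For $(\varphi,\omega)\in C^2(\mathfrak g;M)$, $\delta^2(\varphi,\omega)=(\delta_{\rm cl.}\varphi,\beta)$ with $$\beta(g,h)=\varphi(g,h^{[p]})-\sum_{i+j=p-1}(-1)^ih^i\varphi([g,\underbrace{h,\dots,h}_j],h)+g\,\omega(h).$$ $H^2(\mathfrak g;M)=\ker\delta^2/\operatorname{im}\delta^1$. Here $M=\mathfrak g$ with $g\cdot x=[g,x]$. *)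

(* Defs.v *)
From HB Require Import structures.
From mathcomp Require Import all_boot all_algebra.
From mathcomp Require Import classical_sets functions.

Set Implicit Arguments.
Unset Strict Implicit.
Unset Printing Implicit Defensive.

Import GRing.Theory.
Local Open Scope ring_scope.
Local Open Scope classical_set_scope.

Definition bilinear_map (F : fieldType) (U V W : lmodType F)
    (b : U -> V -> W) : Prop :=
  (forall y, linear (b^~ y)) /\ (forall x, linear (b x)).

Definition alternating (F : fieldType) (V W : lmodType F)
    (b : V -> V -> W) : Prop := forall x, b x x = 0.

Definition jacobi_identity (F : fieldType) (W : lmodType F)
    (br : W -> W -> W) : Prop :=
  forall x y z, br (br x y) z + br (br y z) x + br (br z x) y = 0.

(* [g_1, ..., g_k], left-normed. *)
Definition lnormed (F : fieldType) (W : lmodType F) (br : W -> W -> W)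
    (s : seq W) : W := if s is x :: s' then foldl br x s' else 0.

(* A word of length p in the two letters g, h is coded by a boolean tuple,
   with [true] standing for the (formal) letter g and [false] for h. *)
Definition word (V : Type) (g h : V) (w : seq bool) : seq V :=
  [seq if b then g else h | b <- w].

Definition starts_gh (w : seq bool) : bool := nth false w 0 && ~~ nth true w 1.

Definition inv_count (F : fieldType) (w : seq bool) : F :=
  (count_mem true w)%:R^-1.

(* (R1), (R2), (R3), for a bracket on W and a p-map given on V with values in
   W, where [iota] embeds V into W.  A restricted structure on g is the case
   V = W = g, iota = id; for deformations modulo t^2, V = g and
   W = (F[t]/(t^2)) (x) g. *)
Definition pmap_R1 (F : fieldType) (p : nat) (V W : lmodType F)
    (pm : V -> W) : Prop :=
  forall (a : F) (g : V), pm (a *: g) = a ^+ p *: pm g.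

Definition pmap_R2 (F : fieldType) (p : nat) (V W : lmodType F)
    (iota : V -> W) (br : W -> W -> W) (pm : V -> W) : Prop :=
  forall g h : V, pm (g + h) = pm g + pm h +
    \sum_(w : p.-tuple bool | starts_gh w)
      inv_count F w *: lnormed br (word (iota g) (iota h) w).

Definition pmap_R3 (F : fieldType) (p : nat) (V W : lmodType F)
    (iota : V -> W) (br : W -> W -> W) (pm : V -> W) : Prop :=
  forall g h : V, br (iota g) (pm h) = lnormed br (iota g :: nseq p (iota h)).

HB.mixin Record Lmodule_isLieAlgebra (F : fieldType) g of GRing.Lmodule F g := {
  bracket : g -> g -> g;
  bracket_bilinear : bilinear_map bracket;
  bracket_alternating : alternating bracket;
  bracket_jacobi : jacobi_identity bracket
}.

#[short(type="lieAlgebraType")]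
HB.structure Definition LieAlgebra (F : fieldType) :=
  {g of Lmodule_isLieAlgebra F g & GRing.Lmodule F g}.

(* The prime p is a parameter; that it is the characteristic of F is assumed
   where the structure is used. *)
HB.mixin Record LieAlgebra_isRestricted (F : fieldType) (p : nat) g
    of LieAlgebra F g := {
  ppow : g -> g;
  pmapR1 : pmap_R1 p ppow;
  pmapR2 : pmap_R2 p id bracket ppow;
  pmapR3 : pmap_R3 p id bracket ppow
}.

#[short(type="restrictedLieType")]
HB.structure Definition RestrictedLie (F : fieldType) (p : nat) :=
  {g of LieAlgebra_isRestricted F p g & LieAlgebra F g}.

Record restrictedModule (F : fieldType) (p : nat) (g : restrictedLieType F p)
    (M : lmodType F) := RestrictedModule {
  act : g -> M -> M;
  act_bilinear : bilinear_map act;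
  act_bracket : forall (x y : g) (m : M),
    act (bracket x y) m = act x (act y m) - act y (act x m);
  act_pmap : forall (x : g) (m : M), act (ppow x) m = iter p (act x) m
}.

Section Adjoint.
Variables (F : fieldType) (p : nat) (charFp : p \in [pchar F]).
Variable g : restrictedLieType F p.

Lemma bracketC (x y : g) : bracket x y = - bracket y x.
Proof.
have [Dl Dr] := @bracket_bilinear F g.
have addl (a b c : g) : bracket (a + b) c = bracket a c + bracket b c.
  by have := Dl c 1 a b; rewrite !scale1r.
have addr (a b c : g) : bracket c (a + b) = bracket c a + bracket c b.
  by have := Dr c 1 a b; rewrite !scale1r.
have := @bracket_alternating F g (x + y).
rewrite addl !addr !(@bracket_alternating F g) add0r addr0.
by move/eqP; rewrite addr_eq0 => /eqP.
Qed.

Lemma bracketN (x y : g) : bracket x (- y) = - bracket x y.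
Proof.
have [_ Dr] := @bracket_bilinear F g.
have b0 : bracket x 0 = 0 :> g.
  by have := Dr x (-1) 0 0; rewrite !scaleN1r oppr0 addr0 addNr.
by have := Dr x (-1) y 0; rewrite !scaleN1r !addr0 b0 addr0.
Qed.

Lemma ad_bracket (x y m : g) : bracket (bracket x y) m =
  bracket x (bracket y m) - bracket y (bracket x m).
Proof.
have := @bracket_jacobi F g x y m.
rewrite (bracketC (bracket y m)) (bracketC (bracket m x)) (bracketC m x).
rewrite bracketN opprK -addrA => /eqP; rewrite addr_eq0 => /eqP ->.
by rewrite opprD opprK.
Qed.

Lemma foldl_bracket_nseq n (x m : g) :
  foldl bracket m (nseq n x) = (-1) ^+ n *: iter n (bracket x) m.
Proof.
have Dr := (@bracket_bilinear F g).2.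
have Z (a : F) (u : g) : bracket x (a *: u) = a *: bracket x u.
  have b0 : bracket x 0 = 0 :> g.
    by have := Dr x (-1) 0 0; rewrite !scaleN1r oppr0 addr0 addNr.
  by have := Dr x a u 0; rewrite !addr0 b0 addr0.
elim: n m => [|n IH] m; first by rewrite expr0 scale1r.
rewrite [LHS]/= IH (bracketC m) exprSr mulrN1 scaleNr.
have -> (u : g) : iter n (bracket x) (- u) = - iter n (bracket x) u.
  by elim: n {IH} => //= n ->; rewrite bracketN.
by rewrite -iterSr scalerN.
Qed.

Lemma ad_pmap (x m : g) : bracket (ppow x) m = iter p (bracket x) m.
Proof.
have sgn : (-1) ^+ p = -1 :> F.
  have := pFrobenius_autN charFp 1.
  by rewrite !pFrobenius_autE expr1n.
rewrite bracketC (@pmapR3 F p g m x) [lnormed _ _]/= foldl_bracket_nseq.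
by rewrite sgn scaleN1r opprK.
Qed.

Definition adjoint : restrictedModule g g :=
  RestrictedModule (@bracket_bilinear F g) ad_bracket ad_pmap.

End Adjoint.

Section Cohomology.
Variables (F : fieldType) (p : nat) (g : restrictedLieType F p).
Variables (M : lmodType F) (rho : restrictedModule g M).

Local Notation "x ** m" := (act rho x m) (at level 40, left associativity).

(* Underlying pairs of functions; C2 below cuts out C^2(g; M). *)
Definition cochain2 : Type := ((g -> g -> M) * (g -> M))%type.

(* g_p ... g_{p-k+1} phi([g_1, ..., g_{p-k-1}], g_{p-k}), where
   s = [:: g_1; ...; g_p]. *)
Definition star_term (phi : g -> g -> M) (s : seq g) (k : nat) : M :=
  foldl (fun m x => x ** m)
    (phi (lnormed bracket (take (p - k - 1) s)) (nth 0 s (p - k - 1)))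
    (drop (p - k) s).

Definition star_property (phi : g -> g -> M) (omega : g -> M) : Prop :=
  (forall (a : F) (x : g), omega (a *: x) = a ^+ p *: omega x) /\
  (forall x y : g, omega (x + y) = omega x + omega y +
    \sum_(w : p.-tuple bool | starts_gh w)
      inv_count F w *:
        \sum_(k < p.-1) (-1) ^+ k *: star_term phi (word x y w) k).

Definition C2 : set cochain2 :=
  [set c | [/\ bilinear_map c.1, alternating c.1 & star_property c.1 c.2]].

Definition delta_cl1 (psi : g -> M) (x y : g) : M :=
  - (x ** psi y) + y ** psi x + psi (bracket x y).

Definition delta_cl2 (phi : g -> g -> M) (x y z : g) : M :=
  phi (bracket x y) z - phi (bracket x z) y + phi (bracket y z) x
  - x ** phi y z + y ** phi x z - z ** phi x y.

Definition delta1 (psi : {linear g -> M}) : cochain2 :=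
  (delta_cl1 psi, fun x => psi (ppow x) - iter p.-1 (act rho x) (psi x)).

Definition delta2 (c : cochain2) : (g -> g -> g -> M) * (g -> g -> M) :=
  (delta_cl2 c.1,
   fun x y => c.1 x (ppow y)
     - \sum_(i < p) (-1) ^+ i *:
         iter i (act rho y)
           (c.1 (lnormed bracket (x :: nseq (p.-1 - i) y)) y)
     + x ** c.2 y).

Definition Z2 : set cochain2 := [set c | C2 c /\ delta2 c = 0].

Definition B2 : set cochain2 := range delta1.

Definition coh_class (c : cochain2) : set cochain2 := [set c + b | b in B2].

(* H^2(g; M) = Z2 / B2, as the set of cosets of B2 in Z2. *)
Definition H2 : set (set cochain2) := [set coh_class c | c in Z2].

End Cohomology.

Section Deformations.
Variables (F : fieldType) (p : nat) (g : restrictedLieType F p).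

(* (F[t]/(t^2)) (x) g: the pair (x, y) stands for x + y t. *)
Definition dual : lmodType F := (g * g)%type.

Definition dual_inj (x : g) : dual := (x, 0).

Definition tmul (u : dual) : dual := (0, u.1).

(* The F[t]/(t^2)-bilinear extension of b, the t^2 term being dropped. *)
Definition dual_ext (b : g -> g -> dual) (u v : dual) : dual :=
  b u.1 v.1 + tmul (b u.1 v.2 + b u.2 v.1).

Definition bracket_t (phi : g -> g -> g) : dual -> dual -> dual :=
  dual_ext (fun x y => (bracket x y, phi x y)).

Definition pmap_t (omega : g -> g) (x : g) : dual := (ppow x, omega x).

Definition deformations : set ((g -> g -> g) * (g -> g)) :=
  [set d | [/\ bilinear_map d.1, alternating d.1,
               jacobi_identity (bracket_t d.1)
             & [/\ pmap_R1 p (pmap_t d.2),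
                   pmap_R2 p dual_inj (bracket_t d.1) (pmap_t d.2)
                 & pmap_R3 p dual_inj (bracket_t d.1) (pmap_t d.2)]]].

Definition equivalent (d1 d2 : (g -> g -> g) * (g -> g)) : Prop :=
  exists psi : {linear g -> g},
    (forall x y, d1.1 x y - d2.1 x y =
       psi (bracket x y) - bracket x (psi y) - bracket (psi x) y) /\
    (forall x, d1.2 x - d2.2 x =
       psi (ppow x) - lnormed bracket (psi x :: nseq p.-1 x)).

Definition deformation_class (d : (g -> g -> g) * (g -> g)) :
    set ((g -> g -> g) * (g -> g)) :=
  [set d' | deformations d' /\ equivalent d d'].

Definition deformation_classes : set (set ((g -> g -> g) * (g -> g))) :=
  [set deformation_class d | d in deformations].

End Deformations.

Arguments deformations {F p} g _.
Arguments deformation_classes {F p} g _.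

(* Main.v *)
(* Comparing coefficients of t, the equations of a deformation are exactly the
   cocycle conditions, so deformations are 2-cocycles and equivalence is
   congruence modulo coboundaries, provided coboundaries are cocycles.

   The coboundary of psi is the trivial structure on the dual numbers over g
   transported along x + y t |-> x + (psi x - y) t.  It satisfies (R2) and (R3)
   because x + y t |-> x^[p] + [y, x, ..., x] t does.  To see the latter without
   an enveloping algebra, substitute x + lam y for x in (R2) and (R3) of g: both
   sides are polynomials in lam of degree at most p, whose coefficients of lam^p
   agree by the same axioms for the y's.  Having the p distinct roots
   0, ..., p - 1, the difference vanishes identically, even over the prime
   field, and its coefficient of lam is the wanted identity. *)
Require Import Defs.
From HB Require Import structures.
From mathcomp Require Import all_boot all_algebra.
From mathcomp Require Import boolp classical_sets functions.

Set Implicit Arguments.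
Unset Strict Implicit.
Unset Printing Implicit Defensive.

Import GRing.Theory.
Local Open Scope ring_scope.
Local Open Scope classical_set_scope.

(** * Vector-valued polynomials vanishing on the prime field *)

Lemma vandermonde_natr (F : fieldType) (p : nat) (charFp : p \in [pchar F]) :
  Vandermonde p (\row_(j < p) j%:R : 'rV[F]_p) \in unitmx.
Proof.
(* The determinant is the product of the differences [j - i] with [i < j < p], none of them
   divisible by [p]. *)
rewrite unitmxE det_Vandermonde unitfE; apply/prodf_neq0 => i _.
apply/prodf_neq0 => j ltij; rewrite !mxE -natrB 1?ltnW//.
rewrite -(dvdn_pcharf charFp) gtnNdvd ?subn_gt0//.
by rewrite (leq_ltn_trans (leq_subr _ _)).
Qed.

(** Frobenius is additive, so [(-1) ^+ p = -1], also for [p = 2]; one factor is then cancelled. *)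
Lemma pcharf_sign (F : fieldType) (p : nat) (charFp : p \in [pchar F]) :
  (-1) ^+ p.-1 = 1 :> F.
Proof.
have := pFrobenius_autN charFp 1; rewrite !pFrobenius_autE expr1n.
rewrite -[in X in X -> _](prednK (prime_gt0 (pcharf_prime charFp))).
rewrite exprS mulN1r.
exact: oppr_inj.
Qed.

(* Sequences c with c_k = 0 for k > n stand for the polynomials
   sum_(k <= n) c_k lam^k with vector coefficients; [peval n c lam] is the
   value at lam. *)
Definition peval (F : fieldType) (V : lmodType F) (n : nat) (c : nat -> V)
  (lam : F) : V := \sum_(k < n.+1) lam ^+ k *: c k.

(** As [c p = 0], only [p] coefficients remain, and the values at [0, ..., p - 1] determine them
    through an invertible Vandermonde matrix. *)
Lemma peval_coef_eq0 (F : fieldType) (p : nat) (charFp : p \in [pchar F])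
    (V : lmodType F) (c : nat -> V) :
  (forall lam : F, peval p c lam = 0) -> c p = 0 ->
  forall k, (k < p)%N -> c k = 0.
Proof.
move=> c0 cp k ltkp; pose A := Vandermonde p (\row_(j < p) j%:R : 'rV[F]_p).
have cj (j : 'I_p) : \sum_(i < p) A i j *: c i = 0.
  have := c0 j%:R; rewrite /peval big_ord_recr/= cp scaler0 addr0 => cj.
  by rewrite -[RHS]cj; apply: eq_bigr => i _; rewrite !mxE.
have AV : A *m invmx A = 1%:M by rewrite mulmxV ?vandermonde_natr.
(* Weighting the values by a column of the inverse matrix isolates [c k]. *)
transitivity (\sum_(j < p) invmx A j (Ordinal ltkp) *:
    \sum_(i < p) A i j *: c i); last first.
  by rewrite big1// => j _; rewrite cj scaler0.
under eq_bigr do rewrite scaler_sumr; rewrite exchange_big/=.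
have Ak i : \sum_(j < p) invmx A j (Ordinal ltkp) *: (A i j *: c i) =
    (i == Ordinal ltkp)%:R *: c i.
  have := congr1 (fun B : 'M[F]_p => B i (Ordinal ltkp)) AV.
  rewrite !mxE => <-; rewrite scaler_suml; apply: eq_bigr => j _.
  by rewrite scalerA mulrC.
under eq_bigr do rewrite Ak.
rewrite (bigD1 (Ordinal ltkp))//= eqxx scale1r big1 ?addr0// => i /negPf->.
by rewrite scale0r.
Qed.

Lemma pevalD (F : fieldType) (V : lmodType F) n (c d : nat -> V) lam :
  peval n (fun k => c k + d k) lam = peval n c lam + peval n d lam.
Proof. by rewrite -big_split; apply: eq_bigr => i _; rewrite scalerDr. Qed.

Lemma pevalZ (F : fieldType) (V : lmodType F) n a (c : nat -> V) lam :
  peval n (fun k => a *: c k) lam = a *: peval n c lam.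
Proof.
by rewrite scaler_sumr; apply: eq_bigr => i _; rewrite !scalerA mulrC.
Qed.

Lemma peval_sum (F : fieldType) (V : lmodType F) n (I : Type) (r : seq I)
    (P : pred I) (c : I -> nat -> V) lam :
  peval n (fun k => \sum_(i <- r | P i) c i k) lam =
  \sum_(i <- r | P i) peval n (c i) lam.
Proof.
by rewrite exchange_big; apply: eq_bigr => i _; rewrite scaler_sumr.
Qed.

Lemma peval_binomial (F : fieldType) (V : lmodType F) n (a b : V) lam :
  (0 < n)%N ->
  peval n (fun k => if k == 0 then a else if k == n then b else 0) lam =
  a + lam ^+ n *: b.
Proof.
case: n => // n _; rewrite /peval big_ord_recl big_ord_recr/= expr0 scale1r.
rewrite eqxx big1 ?add0r// => i _.
by rewrite /bump leq0n add1n eqSS ltn_eqF// scaler0.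
Qed.

(** * Left-normed brackets of polynomials of degree at most one *)

Section Bracket.
Variables (F : fieldType) (g : lieAlgebraType F).
Implicit Types (x y z : g) (c : nat -> g) (s : seq (g * g)).

Lemma bracketDl x y z : bracket (x + y) z = bracket x z + bracket y z.
Proof. by have := (@bracket_bilinear F g).1 z 1 x y; rewrite !scale1r. Qed.

Lemma bracketDr x y z : bracket z (x + y) = bracket z x + bracket z y.
Proof. by have := (@bracket_bilinear F g).2 z 1 x y; rewrite !scale1r. Qed.

Lemma bracket0l x : bracket 0 x = 0.
Proof. by apply: (addrI (bracket 0 x)); rewrite -bracketDl !addr0. Qed.

Lemma bracket0r x : bracket x 0 = 0.
Proof. by apply: (addrI (bracket x 0)); rewrite -bracketDr !addr0. Qed.

Lemma bracketZl a x y : bracket (a *: x) y = a *: bracket x y.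
Proof.
by have := (@bracket_bilinear F g).1 y a x 0; rewrite bracket0l !addr0.
Qed.

Lemma bracketZr a x y : bracket x (a *: y) = a *: bracket x y.
Proof.
by have := (@bracket_bilinear F g).2 x a y 0; rewrite bracket0r !addr0.
Qed.

Lemma bracketNl x y : bracket (- x) y = - bracket x y.
Proof. by rewrite -scaleN1r bracketZl scaleN1r. Qed.

Lemma bracket_suml I (r : seq I) (P : pred I) (f : I -> g) y :
  bracket (\sum_(i <- r | P i) f i) y = \sum_(i <- r | P i) bracket (f i) y.
Proof.
by apply: (big_morph (bracket^~ y)) => [u v|]; rewrite ?bracketDl ?bracket0l.
Qed.

Lemma bracket_sumr I (r : seq I) (P : pred I) (f : I -> g) y :
  bracket y (\sum_(i <- r | P i) f i) = \sum_(i <- r | P i) bracket y (f i).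
Proof.
by apply: (big_morph (bracket y)) => [u v|]; rewrite ?bracketDr ?bracket0r.
Qed.

Lemma foldl_bracket0 (s : seq g) : foldl bracket 0 s = 0 :> g.
Proof. by elim: s => //= z s IH; rewrite bracket0l. Qed.

Lemma foldl_bracketZ a x (s : seq g) :
  foldl bracket (a *: x) s = a *: foldl bracket x s.
Proof. by elim: s x => //= z s IH x; rewrite bracketZl IH. Qed.

(* Coefficients of the bracket of the polynomial c with u.1 + lam u.2. *)
Definition pbracket c (u : g * g) (k : nat) : g :=
  bracket (c k) u.1 + (if k is j.+1 then bracket (c j) u.2 else 0).

Definition pline (u : g * g) (k : nat) : g :=
  match k with 0 => u.1 | 1 => u.2 | _ => 0 end.

Lemma peval_pline u lam : peval 1 (pline u) lam = u.1 + lam *: u.2.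
Proof.
by rewrite /peval !big_ord_recr big_ord0/= add0r expr0 scale1r expr1.
Qed.

Definition pdeg_le n c := forall k, (n < k)%N -> c k = 0.

Lemma pdeg_pline u : pdeg_le 1 (pline u).
Proof. by case=> [|[]]. Qed.

Lemma pdeg_pbracket n c u : pdeg_le n c -> pdeg_le n.+1 (pbracket c u).
Proof.
by move=> cn [//|k] ltnk; rewrite /pbracket !cn ?bracket0l ?addr0// ltnW.
Qed.

Lemma peval_foldl_pbracket n c s lam : pdeg_le n c ->
  peval (n + size s) (foldl pbracket c s) lam =
  foldl bracket (peval n c lam) [seq u.1 + lam *: u.2 | u <- s].
Proof.
elim: s n c => [|u s IH] n c cn; first by rewrite addn0.
rewrite /= addnS -addSn IH; last exact: pdeg_pbracket.
congr foldl; rewrite /peval bracketDr big_ord_recl/= {1}/pbracket addr0.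
rewrite [X in _ = X + _]bracket_suml bracketZr bracket_suml scaler_sumr.
rewrite [X in _ = X + _]big_ord_recl/= bracketZl -addrA; congr (_ + _).
under eq_bigr => i _ do rewrite /bump leq0n add1n /pbracket scalerDr.
rewrite big_split/=; congr (_ + _).
  (* The top summand contains [c n.+1], which is 0 by the degree bound. *)
  rewrite big_ord_recr/= cn// bracket0l scaler0 addr0.
  by apply: eq_bigr => i _; rewrite bracketZl.
by apply: eq_bigr => i _; rewrite bracketZl scalerA exprS.
Qed.

(** Each letter raises the degree bound by one, and the new top coefficient can only come from the
    [lam]-part of that letter. *)
Lemma coef_top_foldl_pbracket n c s : pdeg_le n c ->
  foldl pbracket c s (n + size s)%N = foldl bracket (c n) [seq u.2 | u <- s].
Proof.
elim: s n c => [|u s IH] n c cn; first by rewrite addn0.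
rewrite /= addnS -addSn IH; last exact: pdeg_pbracket.
by rewrite /pbracket cn// bracket0l add0r.
Qed.

(* Coefficients of the left-normed bracket of the word s of polynomials
   u.1 + lam u.2. *)
Definition lcoef s (k : nat) : g :=
  if s is u :: s' then foldl pbracket (pline u) s' k else 0.

Lemma peval_lcoef s lam :
  peval (size s) (lcoef s) lam =
  lnormed bracket [seq u.1 + lam *: u.2 | u <- s].
Proof.
case: s => [|u s] /=.
  by rewrite /peval big_ord_recl big_ord0 scaler0 addr0.
by rewrite -add1n -peval_pline; apply/peval_foldl_pbracket/pdeg_pline.
Qed.

Lemma lcoef_top s : lcoef s (size s) = lnormed bracket [seq u.2 | u <- s].
Proof.
case: s => //= u s; rewrite -add1n.
by rewrite coef_top_foldl_pbracket//; apply: pdeg_pline.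
Qed.

End Bracket.

Lemma map_word (T T' : Type) (f : T -> T') (x y : T) (w : seq bool) :
  map f (word x y w) = word (f x) (f y) w.
Proof. by rewrite /word -map_comp; apply: eq_map => -[]. Qed.

Lemma size_word (T : Type) (x y : T) (w : seq bool) :
  size (word x y w) = size w.
Proof. exact: size_map. Qed.

(** * The derivative of the p-map, computed over the dual numbers with undeformed bracket *)

Section Tangent.
Variables (F : fieldType) (p : nat) (charFp : p \in [pchar F]).
Variable g : restrictedLieType F p.
Implicit Types (x y z : g) (c : nat -> g) (s : seq (g * g)).

Let p_gt1 : (1 < p)%N. Proof. exact/prime_gt1/(pcharf_prime charFp). Qed.
Let pKK : p.-2.+2 = p. Proof. by case: p p_gt1 => [|[]]. Qed.

Local Notation bracket0 := (bracket_t (fun _ _ : g => 0)).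

Lemma bracket_tE (phi : g -> g -> g) x y z t :
  bracket_t phi (x, y) (z, t) =
  (bracket x z, phi x z + (bracket x t + bracket y z)).
Proof. by apply: injective_projections; rewrite /= ?addr0. Qed.

(** A pair encodes both a polynomial [u.1 + lam u.2] and a dual number; reduction modulo [lam ^+ 2]
    respects brackets. *)
Lemma foldl_bracket0E c s :
  foldl bracket0 (c 0, c 1) s =
  (foldl (@pbracket F g) c s 0, foldl (@pbracket F g) c s 1).
Proof.
elim: s c => //= -[x y] s IH c; rewrite -IH bracket_tE; congr foldl.
by rewrite /pbracket/= addr0 add0r addrC.
Qed.

(** As [t ^+ 2 = 0], the extra term [z t] meets only the constant parts of the later letters. *)
Lemma foldl_bracket0D x y z s :
  (foldl bracket0 (x, y + z) s).2 =
  (foldl bracket0 (x, y) s).2 + foldl bracket z [seq u.1 | u <- s].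
Proof.
elim: s x y z => //= -[x' y'] s IH x y z.
by rewrite !bracket_tE bracketDl !add0r addrA IH.
Qed.

Lemma lnormed_bracket0 s : lnormed bracket0 s = (lcoef s 0, lcoef s 1).
Proof. by case: s => //= -[x y] s; apply: (foldl_bracket0E (pline (x, y))). Qed.

(* The t-coefficient of the p-map at x + y t. *)
Definition dpmap x y : g := foldl bracket y (nseq p.-1 x).

Lemma foldl_bracket0_vertical y s :
  foldl bracket0 (0, y) s = (0, foldl bracket y [seq u.1 | u <- s]).
Proof.
elim: s y => //= -[x z] s IH y.
by rewrite bracket_tE !bracket0l !add0r IH.
Qed.

Lemma foldl_bracket_word0 x y (w : seq bool) :
  foldl bracket y (word x 0 w) =
  if all id w then foldl bracket y (nseq (size w) x) else 0.
Proof.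
elim: w y => //= -[] w IH y /=; first exact: IH.
by rewrite bracket0r foldl_bracket0.
Qed.

(** Only words with a single [y] are linear in it, and [starts_gh] puts that letter second. The one
    such word has [p - 1] letters [x], and [1 / (p - 1) = -1] cancels the sign of [[x, y] = -
    [y, x]]. *)
Lemma lnormed_words_dpmap x y :
  \sum_(w : p.-tuple bool | starts_gh w)
    inv_count F w *: (lnormed bracket0 (word (x, 0) (0, y) w)).2 = dpmap x y.
Proof.
pose w0s := [:: true, false & nseq p.-2 true].
have w0P : size w0s == p by rewrite /= size_nseq pKK.
have wE (w : seq bool) : starts_gh w ->
    (lnormed bracket0 (word (x, 0) (0, y) w)).2 =
    if all id (drop 2 w) then
      foldl bracket (bracket x y) (nseq (size w).-2 x) else 0.
  case: w => [|[] [|[] w]]//= _.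
  rewrite drop0 bracket_tE bracket0r bracket0l addr0 add0r.
  by rewrite foldl_bracket0_vertical/= map_word foldl_bracket_word0.
rewrite (bigD1 (Tuple w0P))// big1 => [|w /andP[w_gh]].
  rewrite wE//= drop0 all_nseq orbT size_nseq addr0.
  rewrite /inv_count /= count_nseq mul1n add0n add1n.
  rewrite -subn2 -subSn// subSS natrB ?(ltnW p_gt1)// (pcharf0 charFp) sub0r.
  rewrite invrN1 scaleN1r bracketC -[- bracket y x]scaleN1r.
  rewrite foldl_bracketZ scaleN1r opprK.
  by rewrite /dpmap; have -> : p.-1 = (p - 2).+1 by rewrite subn2 -{1}pKK.
(* A word with only [true] after its first two letters would be [w0s], which has been split off. *)
rewrite wE// -val_eqE/= => wnw0; case: ifP => [allw|]; last by rewrite scaler0.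
case/eqP: wnw0; move: w_gh allw (size_tuple w).
case: (tval w) => [|[] [|[] v]]//= _; rewrite drop0 => allv.
rewrite /w0s => <-; congr [:: _, _ & _].
by apply/all_pred1P; apply: sub_all allv => -[].
Qed.

(** The coefficients of [ppow (x + lam *: y)] as a polynomial in [lam], read off from (R1) and
    (R2). *)
Definition pmap_coef x y (k : nat) : g :=
  (if k == 0 then ppow x else if k == p then ppow y else 0) +
  \sum_(w : p.-tuple bool | starts_gh w)
    inv_count F w *: lcoef (word (x, 0) (0, y) w) k.

Lemma peval_lcoef_word x y z t (w : p.-tuple bool) lam :
  peval p (lcoef (word (x, y) (z, t) w)) lam =
  lnormed bracket (word (x + lam *: y) (z + lam *: t) w).
Proof.
have := peval_lcoef (word (x, y) (z, t) w) lam.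
by rewrite size_word size_tuple map_word.
Qed.

Lemma lcoef_word_top x y z t (w : p.-tuple bool) :
  lcoef (word (x, y) (z, t) w) p = lnormed bracket (word y t w).
Proof.
have := lcoef_top (word (x, y) (z, t) w).
by rewrite size_word size_tuple map_word.
Qed.

Lemma lcoef_word1 x y z t (w : p.-tuple bool) :
  lcoef (word (x, y) (z, t) w) 1 =
  (lnormed bracket0 (word (x, y) (z, t) w)).2.
Proof. by rewrite lnormed_bracket0. Qed.

Lemma peval_pmap_coef x y lam :
  peval p (pmap_coef x y) lam = ppow (x + lam *: y).
Proof.
rewrite pevalD peval_sum pmapR2 pmapR1; congr (_ + _); last first.
  apply: eq_bigr => w _.
  by rewrite pevalZ peval_lcoef_word scaler0 addr0 add0r.
by rewrite peval_binomial// ltnW.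
Qed.

(** Every word in the sum starts with the constant [x], so its bracket has degree less than [p]. *)
Lemma pmap_coef_top x y : pmap_coef x y p = ppow y.
Proof.
rewrite /pmap_coef eqxx gtn_eqF ?(ltnW p_gt1)//= big1 ?addr0 // => w.
rewrite lcoef_word_top; case: (tval w) => [|[] v]//= _.
by rewrite foldl_bracket0 scaler0.
Qed.

Lemma pmap_coef1 x y : pmap_coef x y 1 = dpmap x y.
Proof.
rewrite /pmap_coef/= (ltn_eqF p_gt1) add0r -lnormed_words_dpmap.
by apply: eq_bigr => w _; rewrite lcoef_word1.
Qed.

(* (R2) for the map x + y t |-> x^[p] + (dpmap x y) t over the dual numbers. *)
Lemma dpmapD x y z t :
  dpmap (x + z) (y + t) = dpmap x y + dpmap z t +
  \sum_(w : p.-tuple bool | starts_gh w)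
    inv_count F w *: (lnormed bracket0 (word (x, y) (z, t) w)).2.
Proof.
(* The difference of the two sides of (R2) at [x + lam y] and [z + lam t]. *)
pose d k := pmap_coef (x + z) (y + t) k + (-1) *:
  (pmap_coef x y k + pmap_coef z t k + \sum_(w : p.-tuple bool | starts_gh w)
     inv_count F w *: lcoef (word (x, y) (z, t) w) k).
have d0 lam : peval p d lam = 0.
  rewrite pevalD peval_pmap_coef pevalZ 2!pevalD !peval_pmap_coef peval_sum.
  rewrite scaleN1r.
  rewrite scalerDr addrACA pmapR2; apply/eqP; rewrite subr_eq0; apply/eqP.
  congr (_ + _); apply: eq_bigr => w _.
  by rewrite pevalZ peval_lcoef_word.
have dp : d p = 0.
  rewrite /d !pmap_coef_top pmapR2 scaleN1r; apply/eqP; rewrite subr_eq0.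
  apply/eqP; congr (_ + _); apply: eq_bigr => w _.
  by rewrite lcoef_word_top.
have /eqP := peval_coef_eq0 charFp d0 dp p_gt1.
rewrite /d scaleN1r subr_eq0 !pmap_coef1 => /eqP->; congr (_ + _).
by apply: eq_bigr => w _; rewrite lcoef_word1.
Qed.

(* (R3) for the same map. *)
Lemma dpmap_bracket x y z t :
  (lnormed bracket0 ((x, y) :: nseq p (z, t))).2 =
  bracket x (dpmap z t) + bracket y (ppow z).
Proof.
(* The part [y t] of the first letter is split off; (R3) of [g] turns its contribution into
   [bracket y (ppow z)]. *)
rewrite [lnormed _ _]/= -[y in LHS]add0r foldl_bracket0D map_nseq/=.
congr (_ + _); last by rewrite (@pmapR3 F p g).
(* The first letter is now constant, so [p] brackets with [z + lam t] give degree at most [p] rather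
   than [p + 1], as [peval_coef_eq0] requires. *)
pose c := pline (x, 0); pose s := nseq p (z, t).
have c0 : pdeg_le 0 c by case=> [|[]].
pose d k := foldl (@pbracket F g) c s k + (-1) *: bracket x (pmap_coef z t k).
have d0 lam : peval p d lam = 0.
  rewrite pevalD pevalZ scaleN1r.
  have := peval_foldl_pbracket s lam c0.
  rewrite add0n size_nseq map_nseq/= => ->.
  rewrite /(peval 0) big_ord_recl big_ord0 expr0 scale1r addr0/=.
  apply/eqP; rewrite subr_eq0; apply/eqP.
  rewrite -[LHS](@pmapR3 F p g) -peval_pmap_coef bracket_sumr.
  by apply: eq_bigr => i _; rewrite bracketZr.
have dp : d p = 0.
  have := coef_top_foldl_pbracket s c0; rewrite add0n size_nseq map_nseq/=.
  rewrite /d pmap_coef_top scaleN1r => ->; apply/eqP; rewrite subr_eq0.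
  by rewrite (@pmapR3 F p g).
have /eqP := peval_coef_eq0 charFp d0 dp p_gt1.
rewrite /d scaleN1r subr_eq0 pmap_coef1 => /eqP <-.
by rewrite (foldl_bracket0E c).
Qed.

End Tangent.

(** * Bilinear and alternating maps *)

Lemma bilinearNl (F : fieldType) (U V W : lmodType F) (b : U -> V -> W) x y :
  bilinear_map b -> b (- x) y = - b x y.
Proof.
case=> bl _; have bD u v := bl y 1 u v; have := bl y (-1) x 0.
have b0 : b 0 y = 0.
  by have := bl y (-1) 0 0; rewrite !scaleN1r oppr0 addr0 addNr.
by rewrite !scaleN1r !addr0 b0 addr0.
Qed.

Lemma bilinear_mapD (F : fieldType) (U V W : lmodType F) (b b' : U -> V -> W) :
  bilinear_map b -> bilinear_map b' -> bilinear_map (b \+ b').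
Proof.
move=> [bl br] [bl' br']; split=> [y|x] a u v.
  by rewrite -[LHS]/(b _ y + b' _ y) bl bl' addrACA -scalerDr.
by rewrite -[LHS]/(b x _ + b' x _) br br' addrACA -scalerDr.
Qed.

Lemma alternatingC (F : fieldType) (V W : lmodType F) (b : V -> V -> W) x y :
  bilinear_map b -> alternating b -> b x y = - b y x.
Proof.
case=> bl br ba; have := ba (x + y).
have := bl (x + y) 1 x y; rewrite !scale1r => ->.
have := br x 1 x y; rewrite !scale1r => ->.
have := br y 1 x y; rewrite !scale1r => ->.
by rewrite !ba add0r addr0 => /eqP; rewrite addr_eq0 => /eqP.
Qed.

(** * Deformation equations against cocycle conditions *)

Section Cocycles.
Variables (F : fieldType) (p : nat) (charFp : p \in [pchar F]).
Variable g : restrictedLieType F p.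
Implicit Types (x y z : g) (phi : g -> g -> g) (omega : g -> g).

Local Notation bracket0 := (bracket_t (fun _ _ : g => 0)).
Local Notation ad := (adjoint charFp g).

Lemma dual_sum1 I (r : seq I) (P : pred I) (f : I -> dual g) :
  (\sum_(i <- r | P i) f i).1 = \sum_(i <- r | P i) (f i).1.
Proof. exact: (big_morph fst). Qed.

Lemma dual_sum2 I (r : seq I) (P : pred I) (f : I -> dual g) :
  (\sum_(i <- r | P i) f i).2 = \sum_(i <- r | P i) (f i).2.
Proof. exact: (big_morph snd). Qed.

Lemma foldl_bracket_t1 phi (u : dual g) (s : seq (dual g)) :
  (foldl (bracket_t phi) u s).1 = foldl bracket u.1 [seq v.1 | v <- s].
Proof. by elim: s u => //= v s IH u; rewrite IH/= addr0. Qed.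

Lemma lnormed_bracket_t1 phi (s : seq (dual g)) :
  (lnormed (bracket_t phi) s).1 = lnormed bracket [seq v.1 | v <- s].
Proof. by case: s => //= u s; rewrite foldl_bracket_t1. Qed.

(** A Leibniz rule: modulo [t ^+ 2] exactly one of the brackets is replaced by [phi], and [k]
    letters follow it. *)
Lemma lnormed_bracket_t phi (s : seq g) :
  (lnormed (bracket_t phi) (map (@dual_inj _ _ g) s)).2 =
  \sum_(k < (size s).-1)
    foldl bracket (phi (lnormed bracket (take (size s - k - 1) s))
                       (nth 0 s (size s - k - 1)))
      (drop (size s - k) s).
Proof.
elim/last_ind: s => [|s y IH]; first by rewrite big_ord0.
case: s IH => [_|x s IH]; first by rewrite big_ord0.
rewrite map_rcons /= in IH *; rewrite -cats1 foldl_cat/=.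
move: IH; set u := foldl (bracket_t phi) _ _ => IH.
have u1 : u.1 = foldl bracket x s.
  by rewrite /u foldl_bracket_t1/= -map_comp map_id.
case: u u1 IH => _ b /= -> IH.
rewrite IH bracket0r add0r size_rcons -rcons_cons bracket_suml.
have -> : foldl bracket x s = lnormed bracket (x :: s) by [].
move: (x :: s) (size s) (erefl : size (x :: s) = (size s).+1) => t n ts.
(* The summand [k = 0] applies [phi] to the new last letter; the others come from [IH], shifted by
   one. *)
rewrite -cats1 big_ord_recl subn0 subn1/= take_size_cat// nth_cat ts ltnn subnn.
rewrite drop_oversize ?size_cat ?ts ?addn1//; congr (_ + _).
apply: eq_bigr => k _; rewrite /bump leq0n add1n subSS -subnDA addn1.
have dropD m : (m <= size t)%N -> drop m (t ++ [:: y]) = drop m t ++ [:: y].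
  rewrite drop_cat leq_eqVlt; case: ltnP => //= _; rewrite orbF => /eqP->.
  by rewrite subnn drop0 drop_size.
rewrite dropD ?ts ?leq_subr// foldl_cat/= takel_cat ?ts ?leq_subr//.
by rewrite nth_cat ts ltn_subrL.
Qed.

Lemma foldl_act_adjoint (v : g) (s : seq g) :
  foldl (fun m x => act ad x m) v s = (-1) ^+ size s *: foldl bracket v s.
Proof.
elim: s v => [|x s IH] v /=; first by rewrite expr0 scale1r.
rewrite IH exprSr -scalerA bracketC -[- bracket v x]scaleN1r.
by rewrite foldl_bracketZ.
Qed.

(** Turning [k] left actions into right brackets produces a second sign [(-1) ^+ k], leaving the
    Leibniz expansion. *)
Lemma sum_star_term phi (s : seq g) : size s = p ->
  \sum_(k < p.-1) (-1) ^+ k *: star_term ad phi s k =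
  (lnormed (bracket_t phi) (map (@dual_inj _ _ g) s)).2.
Proof.
move=> sp; rewrite lnormed_bracket_t sp; apply: eq_bigr => k _.
rewrite /star_term foldl_act_adjoint size_drop sp subKn.
  by rewrite scalerA -exprD addnn -mul2n exprM sqrrN expr1n expr1n scale1r.
by rewrite ltnW// (leq_trans (ltn_ord k)) ?leq_pred.
Qed.

(** The same cancellation of signs for the word [x, y, ..., y], which has [p + 1] letters and hence
    [p] summands. *)
Lemma sum_iter_adjoint phi x y :
  \sum_(i < p) (-1) ^+ i *:
    iter i (act ad y) (phi (lnormed bracket (x :: nseq (p.-1 - i) y)) y) =
  (lnormed (bracket_t phi) (dual_inj x :: nseq p (dual_inj y))).2.
Proof.
rewrite -map_nseq -map_cons lnormed_bracket_t/= size_nseq.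
apply: eq_bigr => -[i/= ltip] _.
have -> : (p.+1 - i - 1 = (p.-1 - i).+1)%N.
  by case: (p) ltip => // n ltin; rewrite -subnDA addn1 subSS subSn.
have lep : (p.-1 - i <= p)%N by rewrite (leq_trans (leq_subr _ _)) ?leq_pred.
rewrite subSn 1?ltnW//= take_nseq// drop_nseq subKn 1?ltnW// nth_nseq.
rewrite ifT; last first.
  by rewrite (leq_ltn_trans (leq_subr _ _))// prednK// (leq_ltn_trans _ ltip).
by rewrite [RHS]foldl_bracket_nseq.
Qed.

Definition jac phi x y z : g :=
  phi (bracket x y) z + phi (bracket y z) x + phi (bracket z x) y +
  (bracket (phi x y) z + bracket (phi y z) x + bracket (phi z x) y).

(** The t-parts of [u], [v], [w] each contribute a Jacobi sum of [bracket], which vanishes; only the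
    constant parts matter. *)
Lemma jac_bracket_t phi (u v w : dual g) :
  bracket_t phi (bracket_t phi u v) w + bracket_t phi (bracket_t phi v w) u +
    bracket_t phi (bracket_t phi w u) v = (0, jac phi u.1 v.1 w.1).
Proof.
case: u v w => [x a] [y b] [z c]; rewrite !bracket_tE/=.
apply: injective_projections => /=; rewrite !addr0 ?bracket_jacobi//.
rewrite !bracketDl !addrA.
rewrite [LHS](ACl ((1*6*11*(3*8*13))*(2*9*15)*(4*10*12)*(5*7*14))%AC)/=.
by rewrite !bracket_jacobi !addr0.
Qed.

Lemma jacobi_bracket_t phi :
  jacobi_identity (bracket_t phi) <-> forall x y z, jac phi x y z = 0.
Proof.
split=> [J x y z|J u v w]; last by rewrite jac_bracket_t J.
by have := J (x, 0) (y, 0) (z, 0); rewrite jac_bracket_t => -[].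
Qed.

Lemma delta_cl2_jac phi x y z : bilinear_map phi -> alternating phi ->
  delta_cl2 ad phi x y z = jac phi x y z.
Proof.
move=> Hb Ha.
have phiC := alternatingC _ _ Hb Ha; have phiN := bilinearNl _ _ Hb.
rewrite /delta_cl2/= (bracketC x z) phiN opprK (phiC x z) bracketN.
rewrite (bracketC x (phi _ _)) (bracketC y (phi _ _)) (bracketC z (phi _ _)).
by rewrite !opprK /jac !addrA [LHS](ACl (1*3*2*6*4*5)%AC).
Qed.

(* The t-coefficients of the equations defining a deformation. *)
Definition cocycle_eqs phi omega : Prop :=
  [/\ forall x y z, jac phi x y z = 0,
      forall (a : F) x, omega (a *: x) = a ^+ p *: omega x,
      forall x y, omega (x + y) = omega x + omega y +
        \sum_(w : p.-tuple bool | starts_gh w) inv_count F w *: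
          (lnormed (bracket_t phi) (word (dual_inj x) (dual_inj y) w)).2
    & forall x y, phi x (ppow y) + bracket x (omega y) =
        (lnormed (bracket_t phi) (dual_inj x :: nseq p (dual_inj y))).2].

(** The constant coefficients of the equations are the axioms of [g], so only those of [t] impose
    conditions. *)
Lemma deformationsP (d : (g -> g -> g) * (g -> g)) : deformations g d <->
  [/\ bilinear_map d.1, alternating d.1 & cocycle_eqs d.1 d.2].
Proof.
case: d => phi omega; split=> /=.
  case=> /= Hb Ha /jacobi_bracket_t HJ [R1 R2 R3]; split=> //; split=> //.
  - by move=> a x; have [] := R1 a x.
  - move=> x y; have /(congr1 snd) := R2 x y => /= ->.
    by rewrite dual_sum2.
  - move=> x y; have /(congr1 snd) := R3 x y => <-.
    by rewrite bracket_tE bracket0l addr0.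
case=> Hb Ha [HJ R1 R2 R3]; split=> //=; first exact/jacobi_bracket_t.
split.
- by move=> a x; apply: injective_projections; rewrite /= ?pmapR1 ?R1.
- move=> x y; apply: injective_projections; rewrite /= ?dual_sum1 ?dual_sum2.
    rewrite pmapR2; congr (_ + _); apply: eq_bigr => w _ /=.
    by rewrite lnormed_bracket_t1 map_word.
  exact: R2.
- move=> x y; apply: injective_projections; rewrite bracket_tE.
    by rewrite lnormed_bracket_t1/= map_nseq (@pmapR3 F p g).
  by rewrite /= bracket0l addr0 R3.
Qed.

(** The star property matches (R1) and (R2), [delta_cl2] the Jacobi identity, and the second
    component of [delta2] matches (R3). *)
Lemma Z2_adjointP (d : (g -> g -> g) * (g -> g)) : Z2 ad d <->
  [/\ bilinear_map d.1, alternating d.1 & cocycle_eqs d.1 d.2].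
Proof.
case: d => phi omega; have starE x y (w : p.-tuple bool) :
    \sum_(k < p.-1) (-1) ^+ k *: star_term ad phi (word x y w) k =
    (lnormed (bracket_t phi) (word (dual_inj x) (dual_inj y) w)).2.
  by rewrite sum_star_term ?map_word// size_word size_tuple.
split=> /=.
  case=> -[/= Hb Ha [S1 S2]] [D1 D2]; split=> //; split=> //.
  - by move=> x y z; rewrite -delta_cl2_jac// D1.
  - move=> x y; rewrite S2; congr (_ + _); apply: eq_bigr => w _.
    by rewrite starE.
  - move=> x y; rewrite -sum_iter_adjoint; apply/eqP; rewrite -subr_eq0 addrAC.
    by apply/eqP; have /(congr1 (fun f => f x y)) := D2.
case=> Hb Ha [HJ R1 R2 R3]; split; first split=> //=.
  split=> // x y; rewrite R2; congr (_ + _); apply: eq_bigr => w _.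
  by rewrite starE.
congr pair; apply/funext => x; apply/funext => y.
  by apply/funext => z; rewrite /= delta_cl2_jac// HJ.
rewrite sum_iter_adjoint -R3/= addrAC.
exact: subrr.
Qed.

Lemma foldl_bracket_tD phi phi' x y z (s : seq g) :
  (foldl (bracket_t (phi \+ phi')) (x, y + z) (map (@dual_inj _ _ g) s)).2 =
  (foldl (bracket_t phi) (x, y) (map (@dual_inj _ _ g) s)).2 +
  (foldl (bracket_t phi') (x, z) (map (@dual_inj _ _ g) s)).2.
Proof.
elim: s x y z => //= v s IH x y z; rewrite !bracket_tE -IH !bracket0r !add0r.
by congr (foldl _ (_, _) _).2; rewrite bracketDl addrACA.
Qed.

(** Each term of the equations involves [phi] or [omega] linearly, since modulo [t ^+ 2] the
    deformation enters at most once. *)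
Lemma cocycle_eqsD phi omega phi' omega' :
  cocycle_eqs phi omega -> cocycle_eqs phi' omega' ->
  cocycle_eqs (phi \+ phi') (omega \+ omega').
Proof.
have lnD (s : seq g) :
    (lnormed (bracket_t (phi \+ phi')) (map (@dual_inj _ _ g) s)).2 =
    (lnormed (bracket_t phi) (map (@dual_inj _ _ g) s)).2 +
    (lnormed (bracket_t phi') (map (@dual_inj _ _ g) s)).2.
  by case: s => [|x s]/=; rewrite ?addr0// -foldl_bracket_tD addr0.
move=> [J R1 R2 R3] [J' R1' R2' R3']; split.
- move=> x y z; transitivity (jac phi x y z + jac phi' x y z).
    rewrite /jac !bracketDl !addrA.
    by rewrite [LHS](ACl (1*3*5*7*9*11*2*4*6*8*10*12)%AC).
  by rewrite J J' addr0.
- by move=> a x; rewrite /= R1 R1' scalerDr.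
- move=> x y; rewrite -[LHS]/(omega (x + y) + omega' (x + y)) R2 R2'.
  rewrite addrACA [X in X + _]addrACA; congr (_ + _).
  rewrite -big_split; apply: eq_bigr => w _.
  by rewrite -!(map_word (@dual_inj _ _ g)) lnD scalerDr.
- move=> x y; rewrite bracketDr.
  rewrite -[(phi \+ phi') x _]/(phi x (ppow y) + phi' x (ppow y)).
  rewrite addrACA R3 R3'.
  by rewrite -map_nseq -(map_cons (@dual_inj _ _ g)) lnD.
Qed.

(** * Equivalence as congruence modulo coboundaries *)

Lemma delta_cl1E (psi : {linear g -> g}) x y : delta_cl1 ad psi x y =
  psi (bracket x y) - bracket x (psi y) - bracket (psi x) y.
Proof.
rewrite /delta_cl1/= (bracketC y (psi x)).
by rewrite [LHS](ACl (3*1*2)%AC).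
Qed.

(** Passing from left actions to right brackets costs the sign [(-1) ^+ p.-1], which is 1. *)
Lemma delta1_dpmap (psi : {linear g -> g}) x :
  (delta1 ad psi).2 x = psi (ppow x) - dpmap x (psi x).
Proof.
by rewrite /= /dpmap foldl_bracket_nseq pcharf_sign// scale1r.
Qed.

Lemma delta_cl1N (psi : {linear g -> g}) x y :
  delta_cl1 ad (\- psi) x y = - delta_cl1 ad psi x y.
Proof. by rewrite !delta_cl1E bracketNl bracketN !opprD. Qed.

Lemma delta1N (psi : {linear g -> g}) x :
  (delta1 ad (\- psi)).2 x = - (delta1 ad psi).2 x.
Proof.
rewrite !delta1_dpmap opprB addrC; congr (_ - _).
by rewrite /dpmap/= -[- psi x]scaleN1r foldl_bracketZ scaleN1r opprK.
Qed.

Lemma equivalentP (d d' : (g -> g -> g) * (g -> g)) :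
  equivalent d d' <-> exists psi : {linear g -> g}, d' = d + delta1 ad psi.
Proof.
(* Equivalence expresses [d - d'] by [psi], hence [d' - d] by [\- psi]. *)
split=> [[psi [phiE omegaE]]|[psi ->]]; exists (\- psi).
  apply: injective_projections; apply/funext => x.
    apply/funext => y; transitivity (d.1 x y + delta_cl1 ad (\- psi) x y) => //.
    by rewrite delta_cl1N delta_cl1E -phiE opprB addrC subrK.
  transitivity (d.2 x + (delta1 ad (\- psi)).2 x) => //.
  by rewrite delta1N delta1_dpmap -omegaE opprB addrC subrK.
split=> [x y|x].
  rewrite -delta_cl1E delta_cl1N.
  by rewrite -[(d + _).1 x y]/(d.1 x y + delta_cl1 ad psi x y) opprD addNKr.
rewrite -[RHS]/((\- psi) (ppow x) - dpmap x ((\- psi) x)) -delta1_dpmap delta1N.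
by rewrite -[(d + _).2 x]/(d.2 x + (delta1 ad psi).2 x) opprD addNKr.
Qed.

(** * Coboundaries are cocycles *)

Section Coboundary.
Variable psi : {linear g -> g}.

(* An involution intertwining the undeformed bracket on the dual numbers and
   the one deformed by delta psi. *)
Definition conj_dual (u : dual g) : dual g := (u.1, psi u.1 - u.2).

(** Adding [delta_cl1 ad psi x y] turns [[x, psi y] + [psi x, y]] into [psi [x, y]]; the t-parts
    only change sign. *)
Lemma bracket_t_delta_cl1 (u v : dual g) :
  bracket_t (delta_cl1 ad psi) (conj_dual u) (conj_dual v) =
  conj_dual (bracket0 u v).
Proof.
case: u v => [x a] [y b]; rewrite bracket_tE /conj_dual bracket_tE/=.
congr (_, _); rewrite add0r /delta_cl1/= bracketDl bracketDr bracketNl bracketN.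
rewrite (bracketC y (psi x)) opprD !addrA.
by rewrite [LHS](ACl ((1*4)*(2*6)*3*5*7)%AC)/= !addNr !add0r.
Qed.

Lemma lnormed_delta_cl1 (s : seq (dual g)) :
  lnormed (bracket_t (delta_cl1 ad psi)) (map conj_dual s) =
  conj_dual (lnormed bracket0 s).
Proof.
case: s => [|u s]/=.
  by rewrite /conj_dual/= linear0 subr0.
by elim: s u => //= v s IH u; rewrite bracket_t_delta_cl1 IH.
Qed.

(** Exhibits the constants as images under [conj_dual], so that deformed brackets of constants
    reduce to undeformed ones. *)
Lemma dual_inj_conj x : dual_inj x = conj_dual (x, psi x).
Proof. by rewrite /conj_dual/= subrr. Qed.

Lemma delta_cl1_bilinear : bilinear_map (delta_cl1 ad psi).
Proof.
split=> [y|x] a u v; rewrite /delta_cl1/= !linearD !linearZ/=.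
  rewrite !(bracketDl, bracketDr, bracketZl, bracketZr) !linearD !linearZ/=.
  by rewrite [LHS](AC (2*2*2) ((1*3*5)*(2*4*6))).
rewrite !(bracketDl, bracketDr, bracketZl, bracketZr) !linearD !linearZ/=.
by rewrite [LHS](AC (2*2*2) ((1*3*5)*(2*4*6))).
Qed.

Lemma delta_cl1_alternating : alternating (delta_cl1 ad psi).
Proof.
by move=> x; rewrite /delta_cl1/= addNr add0r bracket_alternating linear0.
Qed.

Lemma conj_dualD (u v : dual g) :
  conj_dual (u + v) = conj_dual u + conj_dual v.
Proof.
apply: injective_projections => //=.
by rewrite linearD opprD addrACA.
Qed.

Lemma lnormed_word_delta_cl1 x y (w : p.-tuple bool) :
  (lnormed (bracket_t (delta_cl1 ad psi))
     (word (dual_inj x) (dual_inj y) w)).2 =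
  psi (lnormed bracket (word x y w)) -
  (lnormed bracket0 (word (x, psi x) (y, psi y) w)).2.
Proof.
rewrite !dual_inj_conj -(map_word conj_dual) lnormed_delta_cl1/=.
by rewrite lnormed_bracket_t1 map_word.
Qed.

Lemma dpmapZ (a : F) x y : dpmap (a *: x) (a *: y) = a ^+ p *: dpmap x y.
Proof.
have foldlZ n u v : foldl bracket (a *: u) (nseq n (a *: v)) =
    a ^+ n.+1 *: foldl bracket u (nseq n v) :> g.
  elim: n u => //= n IH u.
  rewrite bracketZl bracketZr [in LHS]foldl_bracketZ IH.
  by rewrite scalerA -exprS.
by rewrite /dpmap foldlZ prednK// (prime_gt0 (pcharf_prime charFp)).
Qed.

(** [conj_dual] sends [(ppow x, dpmap x (psi x))] to [(ppow x, (delta1 ad psi).2 x)], so (R2) and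
    (R3) are transported from [dpmapD] and [dpmap_bracket]. *)
Lemma cocycle_eqs_delta1 :
  cocycle_eqs (delta_cl1 ad psi) (delta1 ad psi).2.
Proof.
split.
- move=> x y z.
  have := jac_bracket_t (delta_cl1 ad psi)
    (dual_inj x) (dual_inj y) (dual_inj z).
  rewrite !dual_inj_conj !bracket_t_delta_cl1 -!conj_dualD jac_bracket_t.
  move=> /(congr1 snd)/= <-.
  (* What is transported is [jac] of the zero deformation, which is 0. *)
  by rewrite /jac !bracket0l !addr0 linear0 subr0.
- by move=> a x; rewrite !delta1_dpmap pmapR1 !linearZ/= dpmapZ scalerBr.
- move=> x y; rewrite !delta1_dpmap pmapR2 !linearD/= (dpmapD charFp).
  rewrite linear_sum.
  under [X in _ = _ + X]eq_bigr do rewrite lnormed_word_delta_cl1 scalerBr.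
  rewrite sumrB opprD addrACA; congr (_ + (_ - _)).
    by rewrite opprD addrACA.
  by apply: eq_bigr => w _; rewrite linearZ.
- move=> x y; rewrite !dual_inj_conj -map_nseq -map_cons lnormed_delta_cl1.
  rewrite [RHS]/=.
  rewrite -[X in _ = _ - X]/
    (lnormed bracket0 ((x, psi x) :: nseq p (y, psi y))).2.
  rewrite (dpmap_bracket charFp) delta1_dpmap foldl_bracket_t1/= map_nseq/=.
  rewrite -[foldl _ _ _]/(lnormed bracket (x :: nseq p y)) -(@pmapR3 F p g).
  rewrite /delta_cl1/= bracketDr bracketN (bracketC (ppow y) (psi x)) opprD.
  rewrite !addrA.
  by rewrite [LHS](ACl ((1*4)*3*5*2)%AC)/= addNr add0r.
Qed.

End Coboundary.

End Cocycles.

Theorem theorem3p29 (F : fieldType) (p : nat) (charFp : p \in [pchar F])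
    (g : restrictedLieType F p) :
  deformation_classes g = H2 (adjoint charFp g) /\
  (forall d : (g -> g -> g) * (g -> g), deformations g d ->
     deformation_class d = coh_class (adjoint charFp g) d).
Proof.
have defZ : deformations g = Z2 (adjoint charFp g).
  apply/seteqP; split=> d.
    by move=> /deformationsP/(Z2_adjointP charFp).
  by move=> /Z2_adjointP/deformationsP.
have classE d : deformations g d ->
    deformation_class d = coh_class (adjoint charFp g) d.
  move=> defd; apply/seteqP; split=> d'.
    case=> _ /(equivalentP charFp)[psi ->].
    by exists (delta1 (adjoint charFp g) psi); first by exists psi.
  case=> _ [psi _ <-] <-; split; last by apply/(equivalentP charFp); exists psi.
  (* Every member of the coset must itself be a deformation: it is a cocycle plus a coboundary. *)
  move/deformationsP: defd => [Hb Ha Hc]; apply/deformationsP; split.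
  - exact: bilinear_mapD (delta_cl1_bilinear charFp psi).
  - move=> x; rewrite -[LHS]/(d.1 x x + delta_cl1 _ _ x x) Ha.
    by rewrite delta_cl1_alternating addr0.
  - by apply: cocycle_eqsD => //; exact: cocycle_eqs_delta1.
split=> //; rewrite /deformation_classes /H2 -defZ.
(* Both sides are images of the same set under two maps that agree on it. *)
by apply/seteqP; split=> _ [d defd <-]; exists d; rewrite ?classE.
Qed.
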